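(* Let $A\le B$ be $k$-element subsets of $[n]$ in the Gale order and let $1\le i\le n-1$ with $i\in B$ and $i+1\notin B$. Suppose that the matroid polytope $P(M[A,B])$ of the lattice path matroid $M[A,B]$ is an MV polytope. Let $B'=(B\setminus\{i\})\cup\{i+1\}$. Then $$\mathbf{e}_i\cdot P(M[A,B])=P(M[A,B']).$$
   Context: The Gale order on $k$-element subsets of $[n]$: for $A=\{a_1<\dots<a_k\}$ and $B=\{b_1<\dots<b_k\}$, $A\le B$ iff $a_j\le b_j$ for all $j$. For $A\le B$, the lattice path matroid $M[A,B]$ is the matroid on $[n]$ whose bases are the sets $R\in\binom{[n]}{k}$ with $A\le R\le B$. With $e_1,\dots,e_n$ the standard basis of $\mathbb{R}^n$ and $e_S=\sum_{i\in S}e_i$, the matroid polytope of $M$ is $P(M)=\operatorname{conv}(e_R:R\text{ a basis of }M)\subseteq\mathbb{R}^n$. A generalized permutahedron on $[n]$ is a polytope $P\subseteq\mathbb{R}^n$ such that every edge of $P$ is parallel to a vector $e_i-e_j$ with $i\neq j$ (points are allowed). It is a lattice generalized permutahedron if all its vertices lie in $\mathbb{Z}^n$. Its submodular function is $\mu_P(S)=\max_{x\in P}\sum_{i\in S}x_i$ for $S\subseteq[n]$; $P$ is determined by $\mu_P$. A lattice generalized permutahedron $P$ is a Mirković–Vilonen (MV) polytope on $[n]$ if for all $S\subseteq[n]$ and all $a<b<c$ in $[n]\setminus S$, $$\mu_P(S\cup\{a,c\})+\mu_P(S\cup\{b\})=\max\bigl(\mu_P(S\cup\{b,c\})+\mu_P(S\cup\{a\}),\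 \mu_P(S\cup\{a,b\})+\mu_P(S\cup\{c\})\bigr).$$ Raising operators: for an MV polytope $P$ on $[n]$ with submodular function $\mu$ and $1\le i\le n-1$, $\mathbf{e}_i\cdot P$ is the MV polytope whose submodular function is $$\mu'(S)=\begin{cases}\max\bigl(\mu(S),\ \mu((S\setminus\{i+1\})\cup\{i\})-c\bigr)&\text{if } i\notin S,\ i+1\in S,\\ \mu(S)&\text{otherwise,}\end{cases}$$ where $c=\mu([n]\setminus s_i[i])-\mu([n]\setminus[i])-1$ and $s_i[i]=\{1,\dots,i-1,i+1\}$ (a theorem of Kamnitzer guarantees this is an MV polytope). *)

(* Defs.v *)
From HB Require Import structures.
From mathcomp Require Import all_boot all_order all_algebra.
From mathcomp Require Import all_classical all_reals convex.

Set Implicit Arguments.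
Unset Strict Implicit.
Unset Printing Implicit Defensive.

Import Order.TTheory GRing.Theory Num.Theory.

Local Open Scope classical_set_scope.
Local Open Scope ring_scope.

(* Throughout, the ground set [n] = {1, ..., n} is 'I_n = {0, ..., n - 1},
   shifted by one. *)

(* The list enum A is increasing, and all2 requires equal lengths. *)
Definition gale_le (n : nat) (A B : {set 'I_n}) : bool :=
  all2 leq [seq val x | x <- enum A] [seq val x | x <- enum B].

(* A matroid is given by its set of bases. *)
Definition lattice_path_matroid (n : nat) (A B : {set 'I_n}) :
    {set {set 'I_n}} :=
  [set D : {set 'I_n} | gale_le A D && gale_le D B]%SET.

Definition conv_hull (R : realType) (n : nat) (X : set 'rV[R]_n) :
    set 'rV[R]_n :=
  smallest (@convex_set R 'rV[R]_n) X.

Definition indicator_vec (R : realType) (n : nat) (S : {set 'I_n}) : 'rV[R]_n :=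
  \sum_(i in S) delta_mx 0 i.

Definition matroid_polytope (R : realType) (n : nat) (M : {set {set 'I_n}}) :
    set 'rV[R]_n :=
  conv_hull [set x | exists2 D, D \in M & x = indicator_vec R D].

Arguments matroid_polytope R {n} M.

Definition polytope (R : realType) (n : nat) (P : set 'rV[R]_n) : Prop :=
  exists s : seq 'rV[R]_n, s != [::] /\ P = conv_hull [set` s].

(* F is the set of points of P where some linear functional, with coefficient
   vector w, attains its maximum over P. *)
Definition face (R : realType) (n : nat) (P F : set 'rV[R]_n) : Prop :=
  exists w : 'rV[R]_n,
    F = [set x | P x /\
         forall y, P y -> \sum_j w 0 j * y 0 j <= \sum_j w 0 j * x 0 j].

Definition vertex (R : realType) (n : nat) (P : set 'rV[R]_n) (v : 'rV[R]_n) :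
    Prop :=
  face P [set v].

(* The edge with endpoints u and v: a one-dimensional face of a polytope is a
   nondegenerate segment. *)
Definition edge (R : realType) (n : nat) (P : set 'rV[R]_n) (u v : 'rV[R]_n) :
    Prop :=
  u != v /\ face P (conv_hull [set u; v]).

Definition generalized_permutahedron (R : realType) (n : nat)
    (P : set 'rV[R]_n) : Prop :=
  polytope P /\
  forall u v, edge P u v ->
    exists (a b : 'I_n) (t : R),
      a != b /\ v - u = t *: (delta_mx 0 a - delta_mx 0 b).

Definition lattice_generalized_permutahedron (R : realType) (n : nat)
    (P : set 'rV[R]_n) : Prop :=
  generalized_permutahedron P /\
  forall v, vertex P v -> forall j, v 0 j \is a Num.int.

(* On a polytope the supremum is attained, so it is the maximum. *)
Definition submod (R : realType) (n : nat) (P : set 'rV[R]_n) (S : {set 'I_n}) :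
    R :=
  sup [set \sum_(j in S) x 0 j | x in P].

Definition MV_polytope (R : realType) (n : nat) (P : set 'rV[R]_n) : Prop :=
  lattice_generalized_permutahedron P /\
  forall (S : {set 'I_n}) (a b c : 'I_n),
    (a < b < c)%N -> a \notin S -> b \notin S -> c \notin S ->
    let mu := submod P in
    mu (a |: (c |: S))%SET + mu (b |: S)%SET =
    Num.max (mu (b |: (c |: S))%SET + mu (a |: S)%SET)
            (mu (a |: (b |: S))%SET + mu (c |: S)%SET).

(* In the next three definitions i' stands for the successor of i. *)

(* c = mu([n] \ s_i[i]) - mu([n] \ [i]) - 1, where [i] = {1, ..., i} and
   s_i[i] = {1, ..., i - 1, i + 1}. *)
Definition raise_const (R : realType) (n : nat) (i i' : 'I_n)
    (mu : {set 'I_n} -> R) : R :=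
  mu (~: (i' |: [set j : 'I_n | (j < i)%N]))%SET
  - mu (~: [set j : 'I_n | (j <= i)%N])%SET - 1.

Definition raise_submod (R : realType) (n : nat) (i i' : 'I_n)
    (mu : {set 'I_n} -> R) (S : {set 'I_n}) : R :=
  if (i \notin S) && (i' \in S)
  then Num.max (mu S) (mu (i |: (S :\ i'))%SET - raise_const i i' mu)
  else mu S.

(* The MV polytope with submodular function raise_submod i i' (submod P). It is
   unique, since an MV polytope is determined by its submodular function; if
   there were none, raising would return the empty set, which is not an MV
   polytope. *)
Definition raising (R : realType) (n : nat) (i i' : 'I_n) (P : set 'rV[R]_n) :
    set 'rV[R]_n :=
  xget set0 [set Q | MV_polytope Q /\
                     forall S, submod Q S = raise_submod i i' (submod P) S].

(* Main.v *)
Require Import Defs.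
From HB Require Import structures.
From mathcomp Require Import all_boot all_order all_algebra.
From mathcomp Require Import all_classical all_reals.
From mathcomp Require Import convex interval_inference zify ring lra.

(* A basis of M[A,B] is a 0/1 lattice path lying between those of A and B, so
   everything can be phrased with the numbers of elements of D below j. The path
   of B' differs from that of B in a single count, and a basis of M[A,B'] that is
   not one of M[A,B] becomes one after replacing i + 1 by i; as the constant in
   the raising operator is 0, the rank function of M[A,B'] is the raised one.
   Every lattice path matroid satisfies the three-term relation at a < b < c:
   symmetric exchange gives it unless c can only be exchanged with a, and then
   the two paths run in parallel at distance one between a and c, so one may
   switch from one to the other at b.

   It remains to see that a generalized permutahedron is determined by its
   submodular function. For a generic functional w, the w-maximal vertex v
   maximises x_S for every upper set S of the order induced by w, since otherwise
   some edge at v would increase x_S, hence would be parallel to e_a - e_b with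
   w_a > w_b and increase w. So v is read off the submodular function, and
   separation by generic functionals concludes. *)

(** * Lattice path matroids *)

Section Combinatorics.
Set Implicit Arguments.
Unset Strict Implicit.
Unset Printing Implicit Defensive.
Local Open Scope nat_scope.
Local Open Scope set_scope.

(* Canonical instances are elaborated through [reverse_coercion] inconsistently,
   which would hide equal atoms from [lia]. *)
Ltac goal_lia := clear; cbv beta delta [reverse_coercion]; lia.

(** * Counting functions and the Gale order *)

Definition cnt n (D : {set 'I_n}) (j : nat) : nat := \sum_(x in D) (x < j).

Lemma cnt0 n (D : {set 'I_n}) : cnt D 0 = 0.
Proof. exact: big1. Qed.

Lemma cnt_full n (D : {set 'I_n}) j : n <= j -> cnt D j = #|D|.
Proof.
move=> nj; rewrite -sum1_card; apply: eq_bigr => x _.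
by rewrite (leq_trans (ltn_ord x) nj).
Qed.

Lemma cntS n (D : {set 'I_n}) (x : 'I_n) : cnt D x.+1 = cnt D x + (x \in D).
Proof.
have cntE j : cnt D j = \sum_(y : 'I_n) ((y \in D) && (y < j)).
  by rewrite /cnt big_mkcond; apply: eq_bigr => y _; case: (y \in D).
rewrite !cntE (bigD1 x)//= [in RHS](bigD1 x)//= ltnn ltnSn andbT andbF add0n addnC.
congr (_ + _); apply: eq_bigr => y nyx; congr (nat_of_bool (_ && _)).
by rewrite ltnS leq_eqVlt [_ == _ :> nat](inj_eq val_inj) (negbTE nyx).
Qed.

(** The additive form avoids truncated subtraction, so that [lia] can combine it with the bounds on
    counts. *)
Lemma cnt_exchange n (D : {set 'I_n}) (c x : 'I_n) j :
  c \in D -> x \notin D -> cnt (x |: (D :\ c)) j + (c < j) = cnt D j + (x < j).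
Proof.
move=> cD xD; rewrite /cnt big_setU1 ?inE ?negb_and ?xD ?orbT//=.
by rewrite [in RHS](big_setD1 c cD)/= [RHS]addnAC addnC addnA.
Qed.

Lemma card_exchange n (D : {set 'I_n}) (c x : 'I_n) :
  c \in D -> x \notin D -> #|x |: (D :\ c)| = #|D|.
Proof.
by move=> cD xD; rewrite cardsU1 !inE (negbTE xD) andbF/= [in RHS](cardsD1 c) cD.
Qed.

Lemma cardI_exchange n (D S : {set 'I_n}) (c x : 'I_n) :
  c \in D -> x \notin D ->
  #|(x |: (D :\ c)) :&: S| + (c \in S) = #|D :&: S| + (x \in S).
Proof.
move=> cD xD.
have cardIE (E : {set 'I_n}) : #|E :&: S| = \sum_(y in E) (y \in S).
  by rewrite -sum1_card big_mkcond [RHS]big_mkcond; apply: eq_bigr => y _;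
    rewrite inE; case: (y \in E); case: (y \in S).
rewrite !cardIE big_setU1 ?inE ?negb_and ?xD ?orbT//=.
by rewrite [in RHS](big_setD1 c cD)/= [RHS]addnAC addnC addnA.
Qed.

Lemma cardIU1 n (D S : {set 'I_n}) (x : 'I_n) :
  x \notin S -> #|D :&: (x |: S)| = (x \in D) + #|D :&: S|.
Proof.
move=> xS; rewrite (cardsD1 x) !inE eqxx/= andbT; congr (_ + #|pred_of_set _|).
by apply/setP => y; rewrite !inE; case: eqVneq => // ->; rewrite (negbTE xS) andbF.
Qed.

Definition cntseq (s : seq nat) j := count (fun x => x < j) s.
Arguments cntseq : simpl never.

(** Smaller entries are counted earlier, so the comparison is reversed. The induction compares the
    heads and then the tails. *)
Lemma all2_leq_cntseq (s t : seq nat) :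
  sorted ltn s -> sorted ltn t -> size s = size t ->
  all2 leq s t <-> (forall j, cntseq t j <= cntseq s j).
Proof.
have cons_cnt z r j : cntseq (z :: r) j = (z < j) + cntseq r j by [].
elim: s t => [|x s IH] [|y t]//= sx sy [sz].
have small z r : path ltn z r -> forall j, j <= z.+1 -> cntseq r j = 0.
  move=> zr j jz; apply/eqP; rewrite -leqn0 leqNgt -has_count.
  apply/hasPn => v vr; rewrite -leqNgt.
  by have /allP/(_ v vr)/= := order_path_min ltn_trans zr; lia.
split=> [/andP[xy /(IH _ (path_sorted sx) (path_sorted sy) sz) H] j|H].
  by rewrite !cons_cnt; have := H j; lia.
(* Otherwise the cutoff [y.+1] counts [y] in [t] but nothing in [s]. *)
have xy : x <= y.
  rewrite leqNgt; apply/negP => yx.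
  by have := H y.+1; rewrite !cons_cnt (small _ _ sx); lia.
(* Above [y.+1] both heads are counted and cancel; up to [y.+1] the tail of [t] contributes
   nothing. *)
rewrite xy/=; apply/(IH _ (path_sorted sx) (path_sorted sy) sz) => j.
by have := H j; rewrite !cons_cnt; case: (leqP j y.+1) => [/(small _ _ sy) ->//|]; lia.
Qed.

Lemma gale_leP n (A B : {set 'I_n}) :
  gale_le A B <-> #|A| = #|B| /\ forall j, cnt B j <= cnt A j.
Proof.
have sortE (D : {set 'I_n}) : sorted ltn [seq val x | x <- enum D].
  apply: (@subseq_sorted _ _ ltn_trans _ (map val (enum 'I_n))).
    by apply: map_subseq; rewrite {1}enumT; exact: filter_subseq.
  by rewrite val_enum_ord iota_ltn_sorted.
have szE (D : {set 'I_n}) : size [seq val x | x <- enum D] = #|D|.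
  by rewrite size_map -cardE.
have cntE (D : {set 'I_n}) j : cntseq [seq val x | x <- enum D] j = cnt D j.
  by rewrite /cntseq /cnt count_map -sum1_count big_mkcond/= -big_enum/=;
    apply: eq_bigr => x _; case: ltnP.
rewrite /gale_le; split=> [H|[AB H]].
  have AB : #|A| = #|B| by move: H; rewrite all2E !szE => /andP[/eqP].
  split=> // j; rewrite -!cntE.
  by move/all2_leq_cntseq : H; apply => //; rewrite !szE.
by apply/all2_leq_cntseq => //; rewrite ?szE// => j; rewrite !cntE.
Qed.

Lemma mem_lattice_path n (A B D : {set 'I_n}) : #|A| = #|B| ->
  D \in lattice_path_matroid A B <->
  #|D| = #|A| /\ forall j, cnt B j <= cnt D j <= cnt A j.
Proof.
move=> AB; rewrite inE; split.
  by move=> /andP[/gale_leP[-> DA] /gale_leP[_ BD]]; split=> // j; rewrite BD DA.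
move=> [DA H]; apply/andP; split; apply/gale_leP; split; rewrite ?DA// => j;
  by have /andP[] := H j.
Qed.

Definition rank n (M : {set {set 'I_n}}) (S : {set 'I_n}) : nat :=
  \max_(D in M) #|D :&: S|.

Lemma rank_ub n (M : {set {set 'I_n}}) (S D : {set 'I_n}) :
  D \in M -> #|D :&: S| <= rank M S.
Proof. by move=> DM; rewrite /rank (bigmax_sup D). Qed.

Lemma rank_attained n (M : {set {set 'I_n}}) (S : {set 'I_n}) :
  M != finset.set0 -> exists2 D, D \in M & #|D :&: S| = rank M S.
Proof.
move=> /finset.set0Pn M0.
have [|D DM e] := @eq_bigmax_cond _ (mem M) (fun D => #|D :&: S|).
  exact/card_gt0P.
by exists D => //; rewrite -e.
Qed.

(** * Symmetric exchange *)

Section Exchange.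
Variables (n : nat) (A B : {set 'I_n}).
Hypothesis AB : #|A| = #|B|.
Local Notation M := (lattice_path_matroid A B).

Lemma lattice_path_card (D1 D2 : {set 'I_n}) : D1 \in M -> D2 \in M -> #|D1| = #|D2|.
Proof. by move=> /(mem_lattice_path _ AB)[-> _] /(mem_lattice_path _ AB)[-> _]. Qed.

(** Being a basis is a pointwise interval condition on the counts. *)
Lemma lattice_path_between (D1 D2 D : {set 'I_n}) :
  D1 \in M -> D2 \in M -> #|D| = #|D1| ->
  (forall j, minn (cnt D1 j) (cnt D2 j) <= cnt D j <= maxn (cnt D1 j) (cnt D2 j)) ->
  D \in M.
Proof.
move=> /(mem_lattice_path _ AB)[c1 b1] /(mem_lattice_path _ AB)[c2 b2] c b.
apply/(mem_lattice_path _ AB); split=> [|j]; first by rewrite c.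
by have := b1 j; have := b2 j; have := b j; lia.
Qed.

Definition exchangeable (D1 D2 : {set 'I_n}) (c x : 'I_n) : Prop :=
  [/\ x \in D2, x \notin D1, x |: (D1 :\ c) \in M & c |: (D2 :\ x) \in M].

(** Moving [c] to [x] lowers the counts of [D1] by one after [c] and up to [x], and the reverse move
    raises those of [D2] by one there. The strict gap keeps both results between the two old
    paths. *)
Lemma exchangeable_right (D1 D2 : {set 'I_n}) (c x : 'I_n) : D1 \in M -> D2 \in M ->
  c \in D1 -> c \notin D2 -> x \in D2 -> x \notin D1 -> c < x ->
  (forall j, c < j <= x -> cnt D2 j < cnt D1 j) -> exchangeable D1 D2 c x.
Proof.
move=> M1 M2 c1 c2 x2 x1 cx H; split=> //.
  apply: (lattice_path_between M1 M2); first by rewrite card_exchange.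
  by move=> j; have := cnt_exchange j c1 x1; have := H j; lia.
apply: (lattice_path_between M2 M1); first by rewrite card_exchange.
by move=> j; have := cnt_exchange j x2 c2; have := H j; lia.
Qed.

Lemma exchangeable_left (D1 D2 : {set 'I_n}) (c x : 'I_n) : D1 \in M -> D2 \in M ->
  c \in D1 -> c \notin D2 -> x \in D2 -> x \notin D1 -> x < c ->
  (forall j, x < j <= c -> cnt D1 j < cnt D2 j) -> exchangeable D1 D2 c x.
Proof.
move=> M1 M2 c1 c2 x2 x1 cx H; split=> //.
  apply: (lattice_path_between M1 M2); first by rewrite card_exchange.
  by move=> j; have := cnt_exchange j c1 x1; have := H j; lia.
apply: (lattice_path_between M2 M1); first by rewrite card_exchange.
by move=> j; have := cnt_exchange j x2 c2; have := H j; lia.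
Qed.

Lemma cntSlt (D : {set 'I_n}) j (jn : j < n) :
  cnt D j.+1 = cnt D j + (Ordinal jn \in D).
Proof. exact: (cntS D (Ordinal jn)). Qed.

(** After [c] the path of [D1] is strictly ahead, and at the end the counts agree. The first place
    where [D2] catches up must be a step of [D2] alone. *)
Lemma next_crossing (D1 D2 : {set 'I_n}) (c : 'I_n) : #|D1| = #|D2| ->
  c \in D1 -> c \notin D2 -> cnt D2 c <= cnt D1 c ->
  exists x : 'I_n, [/\ x \in D2, x \notin D1, c < x, cnt D1 x.+1 <= cnt D2 x.+1 &
    forall j, c < j <= x -> cnt D2 j < cnt D1 j].
Proof.
move=> D12 c1 c2 le.
have cS1 := cntS D1 c; have cS2 := cntS D2 c.
rewrite c1 in cS1; rewrite (negbTE c2) in cS2.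
have ex : exists j, (c <= j) && (cnt D1 j.+1 <= cnt D2 j.+1).
  by exists n; rewrite !cnt_full// D12 leqnn andbT ltnW.
case: (ex_minnP ex) => m /andP[cm lem] min.
have H j : c < j <= m -> cnt D2 j < cnt D1 j.
  move=> /andP[cj jm]; rewrite ltnNge; apply/negP => le'.
  by have := min j.-1; rewrite prednK ?le'; lia.
have cltm : c < m by case: (ltngtP c m) cm lem => // <-; lia.
have mn : m < n.
  by rewrite ltnNge; apply/negP => nm; have := H m; rewrite !cnt_full; lia.
exists (Ordinal mn); split=> //; have := H m;
  have := cntSlt D1 mn; have := cntSlt D2 mn;
  by case: (Ordinal mn \in D2); case: (Ordinal mn \in D1) => //; lia.
Qed.

Lemma prev_crossing (D1 D2 : {set 'I_n}) (c : 'I_n) :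
  c \in D1 -> c \notin D2 -> cnt D1 c < cnt D2 c ->
  exists x : 'I_n, [/\ x \in D2, x \notin D1, x < c, cnt D2 x <= cnt D1 x &
    forall j, x < j <= c -> cnt D1 j < cnt D2 j].
Proof.
move=> c1 c2 lt.
have ex : exists j, (j < c) && (cnt D2 j <= cnt D1 j).
  by exists 0; rewrite !cnt0 leqnn andbT; case: (posnP c) lt => // ->; rewrite !cnt0.
have ub j : (j < c) && (cnt D2 j <= cnt D1 j) -> j <= c by lia.
case: (ex_maxnP ex ub) => m /andP[mc lem] max.
have H j : m < j <= c -> cnt D1 j < cnt D2 j.
  move=> /andP[mj jc]; rewrite ltnNge; apply/negP => le'.
  by have := max j; case: (ltngtP j c) jc le' => // [|->]; lia.
have mn : m < n by apply: ltn_trans mc _.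
exists (Ordinal mn); split=> //; have := H m.+1;
  have := cntSlt D1 mn; have := cntSlt D2 mn;
  by case: (Ordinal mn \in D2); case: (Ordinal mn \in D1) => //; lia.
Qed.

(** If [D1] is not behind at [c], it is strictly ahead just after and a partner is found to the
    right; otherwise [D2] is strictly ahead at [c] and a partner is found to the left, as both
    counts start at zero. *)
Lemma lattice_path_exchange (D1 D2 : {set 'I_n}) (c : 'I_n) : D1 \in M -> D2 \in M ->
  c \in D1 -> c \notin D2 -> exists x, exchangeable D1 D2 c x.
Proof.
move=> M1 M2 c1 c2; have D12 := lattice_path_card M1 M2.
have [le|lt] := leqP (cnt D2 c) (cnt D1 c).
  have [x [x2 x1 cx _ H]] := next_crossing D12 c1 c2 le.
  by exists x; exact: exchangeable_right.
have [x [x2 x1 cx _ H]] := prev_crossing c1 c2 lt.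
by exists x; exact: exchangeable_left.
Qed.

(** This is monotonicity of [cnt D1 - cnt D2], written without subtraction. *)
Lemma cnt_diff_mono (D1 D2 : {set 'I_n}) (lo hi : nat) :
  (forall y : 'I_n, lo <= y < hi -> y \in D2 -> y \in D1) ->
  forall i j, lo <= i -> i <= j -> j <= hi -> j <= n ->
  cnt D1 i + cnt D2 j <= cnt D1 j + cnt D2 i.
Proof.
move=> H i j li; elim: j => [|j IH] ij jh jn; first by have -> : i = 0 by lia.
case: (ltngtP i j.+1) ij => // [ij _|-> _]; last by rewrite addnC.
have jn' : j < n by [].
have := cntSlt D1 jn'; have := cntSlt D2 jn'.
have := IH ij (ltnW jh) (ltnW jn); have := H (Ordinal jn').
by case: (Ordinal jn' \in D2); case: (Ordinal jn' \in D1) => //=; lia.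
Qed.

(* When the only partner of [c] is [a], the two lattice paths run in parallel at
   distance one between [a] and [c], so the step at [b] can be used to switch
   from one to the other. *)
Lemma exchange_or_shift (D1 D2 : {set 'I_n}) (a b c : 'I_n) :
  D1 \in M -> D2 \in M ->
  c \in D1 -> c \notin D2 -> a \in D2 -> a \notin D1 ->
  (a < b < c) || (c < b < a) ->
  (exists2 x, x != a & exchangeable D1 D2 c x) \/
  [/\ (b \in D1) = (b \in D2),
      b \notin D1 -> b |: (D1 :\ c) \in M &
      b \in D1 -> c |: (D2 :\ b) \in M].
Proof.
move=> M1 M2 c1 c2 a2 a1 abc; have D12 := lattice_path_card M1 M2.
have a1S := cntS D1 a; have a2S := cntS D2 a; have an := ltn_ord a; have cn := ltn_ord c.
rewrite a2 (negbTE a1) in a1S a2S.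
have [le|lt] := leqP (cnt D2 c) (cnt D1 c).
  have [x [x2 x1 cx lex H]] := next_crossing D12 c1 c2 le.
  have [xa|xa] := eqVneq x a; last first.
    by left; exists x => //; exact: exchangeable_right.
  subst x.
  (* An element of [D2] outside [D1] strictly between [c] and [a] would be another partner, since
     the gap is positive up to it. *)
  have [/existsP[y /and3P[/andP[cy ya] y2 y1]]|/existsPn none] :=
    boolP [exists y : 'I_n, [&& c < y < a, y \in D2 & y \notin D1]].
    left; exists y.
      by apply/eqP => ya'; move: ya; rewrite ya' ltnn.
    by apply: exchangeable_right => // j cjy; apply: H; clear -cjy cy ya; lia.
  have none' (y : 'I_n) : c < y < a -> y \in D2 -> y \in D1.
    by move=> ya y2; apply/negPn/negP => y1; have := none y; rewrite ya y2 y1.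
  (* The gap is at least one, cannot shrink up to [a], and is at most one at [a], where a single
     step of [D2] closes it. *)
  have d1 j : c < j <= a -> cnt D1 j = (cnt D2 j).+1.
    move=> cja; have := H j cja; have := H a.
    have := @cnt_diff_mono D1 D2 c.+1 a none' j a.
    clear -an a1S a2S lex cja abc cx cn.
    by lia.
  have b_in : (b \in D1) = (b \in D2).
  have := d1 b; have := d1 b.+1; rewrite !cntS; clear -abc cx.
  by case: (b \in D1); case: (b \in D2) => //; lia.
  right; split.
  - exact: b_in.
  - move=> b1; apply: (lattice_path_between M1 M2); first by rewrite card_exchange.
    by move=> j; have := cnt_exchange j c1 b1; have := d1 j; clear -abc cx; lia.
  - move=> b1.
    have b2 : b \in D2 by rewrite -b_in.
    apply: (lattice_path_between M2 M1); first by rewrite card_exchange.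
    by move=> j; have := cnt_exchange j b2 c2; have := d1 j; clear -abc cx; lia.
have [x [x2 x1 cx lex H]] := prev_crossing c1 c2 lt.
have [xa|xa] := eqVneq x a; last first.
  by left; exists x => //; exact: exchangeable_left.
subst x.
have [/existsP[y /and3P[/andP[cy ya] y2 y1]]|/existsPn none] :=
  boolP [exists y : 'I_n, [&& a < y < c, y \in D2 & y \notin D1]].
  left; exists y.
    by apply/eqP => ya'; move: cy; rewrite ya' ltnn.
  by apply: exchangeable_left => // j cjy; apply: H; clear -cjy cy ya; lia.
have none' (y : 'I_n) : a < y < c -> y \in D2 -> y \in D1.
  by move=> ya y2; apply/negPn/negP => y1; have := none y; rewrite ya y2 y1.
have d1 j : a < j <= c -> cnt D2 j = (cnt D1 j).+1.
  move=> cja; have := H j cja; have := H a.+1.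
  have := @cnt_diff_mono D1 D2 a.+1 c none' a.+1 j.
  clear -an a1S a2S lex cja abc cx cn.
  by lia.
have b_in : (b \in D1) = (b \in D2).
  have := d1 b; have := d1 b.+1; rewrite !cntS; clear -abc cx.
  by case: (b \in D1); case: (b \in D2) => //; lia.
right; split.
- exact: b_in.
- move=> b1; apply: (lattice_path_between M1 M2); first by rewrite card_exchange.
  by move=> j; have := cnt_exchange j c1 b1; have := d1 j; clear -abc cx; lia.
- move=> b1.
  have b2 : b \in D2 by rewrite -b_in.
  apply: (lattice_path_between M2 M1); first by rewrite card_exchange.
  by move=> j; have := cnt_exchange j b2 c2; have := d1 j; clear -abc cx; lia.
Qed.

(** * The three-term relation for the rank function *)

Lemma cardIU2 (D S : {set 'I_n}) (x y : 'I_n) : x != y -> x \notin S -> y \notin S ->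
  #|D :&: (x |: (y |: S))| = (x \in D) + (y \in D) + #|D :&: S|.
Proof.
by move=> xy xS yS; rewrite cardIU1 ?inE ?negb_or ?xy// cardIU1// addnA.
Qed.

Hypothesis M0 : M != finset.set0.

(** Bases optimal on the left become candidates on the right by handing [c] from [D1] to [D2].
    Nothing is lost unless [D2] has to give up [a], where the switch at [b] serves instead. Allowing
    both orientations covers both terms of the maximum. *)
Lemma rank_middle_ge (S : {set 'I_n}) (a b c : 'I_n) :
  (a < b < c) || (c < b < a) -> a \notin S -> b \notin S -> c \notin S ->
  rank M (b |: (c |: S)) + rank M (a |: S) <=
  rank M (a |: (c |: S)) + rank M (b |: S).
Proof.
move=> abc aS bS cS.
have [ab bc ac] : [/\ a != b, b != c & a != c].
  by split; apply/eqP => e; move: abc; rewrite e; goal_lia.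
have [D1 M1 <-] := rank_attained (b |: (c |: S)) M0.
have [D2 M2 <-] := rank_attained (a |: S) M0.
have ubac D : D \in M -> (a \in D) + (c \in D) + #|D :&: S| <= rank M (a |: (c |: S)).
  by move=> DM; rewrite -cardIU2// rank_ub.
have ubb D : D \in M -> (b \in D) + #|D :&: S| <= rank M (b |: S).
  by move=> DM; rewrite -cardIU1// rank_ub.
rewrite cardIU2// cardIU1//.
(* If [D1] lacks [c] or [D2] already has it, the two bases themselves serve, [D2] for the larger
   set. *)
have [c1|c1] := boolP (c \in D1); last by have := ubac _ M2; have := ubb _ M1; goal_lia.
have [c2|c2] := boolP (c \in D2).
  by have := ubac _ M2; have := ubb _ M1; rewrite c2; goal_lia.
have [] : (exists2 x, x != a & exchangeable D1 D2 c x) \/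
  [/\ (b \in D1) = (b \in D2), b \notin D1 -> b |: (D1 :\ c) \in M &
      b \in D1 -> c |: (D2 :\ b) \in M].
- have [/andP[a2 a1]|a21] := boolP ((a \in D2) && (a \notin D1)).
    exact: exchange_or_shift abc.
  have [x xE] := lattice_path_exchange M1 M2 c1 c2; left; exists x => //.
  by apply/eqP => xa; case: xE => x2 x1 _ _; move: a21; rewrite -xa x2 x1.
- move=> [x xa [x2 x1 M1' M2']].
  have := ubac _ M2'; have := ubb _ M1'.
  have := cardI_exchange S c1 x1; have := cardI_exchange S x2 c2.
  rewrite !inE eqxx (negbTE ac) bc (eq_sym a) xa/=.
  by case: (b == x) => //=; goal_lia.
move=> [b12 shift1 shift2].
(* Either [D2] trades [b], which its new test set ignores, for [c], or [D1] trades [c] for [b]. *)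
have [b1|b1] := boolP (b \in D1).
  have b2 : b \in D2 by rewrite -b12.
  have := ubac _ (shift2 b1); have := ubb _ M1; have := cardI_exchange S b2 c2.
  by rewrite !inE eqxx (negbTE ac) ab b1 (negbTE cS) (negbTE bS)/=; goal_lia.
have := ubac _ M2; have := ubb _ (shift1 b1); have := cardI_exchange S c1 b1.
by rewrite !inE eqxx (negbTE cS) (negbTE bS)/=; goal_lia.
Qed.

(** If [D2] has [c] or [D1] lacks it, [c] can be credited to [D2] instead of [D1]; likewise for [a].
    Otherwise [a] is exchanged into [D2], and the first or second term of the maximum is reached
    according to whether the partner is [b]. *)
Lemma rank_middle_le (S : {set 'I_n}) (a b c : 'I_n) :
  a != b -> b != c -> a != c -> a \notin S -> b \notin S -> c \notin S ->
  rank M (a |: (c |: S)) + rank M (b |: S) <=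
  maxn (rank M (b |: (c |: S)) + rank M (a |: S))
       (rank M (a |: (b |: S)) + rank M (c |: S)).
Proof.
move=> ab bc ac aS bS cS.
have [D1 M1 <-] := rank_attained (a |: (c |: S)) M0.
have [D2 M2 <-] := rank_attained (b |: S) M0.
have ub1 D x : x \notin S -> D \in M -> (x \in D) + #|D :&: S| <= rank M (x |: S).
  by move=> xS DM; rewrite -cardIU1// rank_ub.
have ub2 D x y : x != y -> x \notin S -> y \notin S -> D \in M ->
    (x \in D) + (y \in D) + #|D :&: S| <= rank M (x |: (y |: S)).
  by move=> xy xS yS DM; rewrite -cardIU2// rank_ub.
rewrite cardIU2// cardIU1//.
have [c12|c12] := leqP (c \in D1) (c \in D2).
  by have := ub2 _ _ _ bc bS cS M2; have := ub1 _ _ aS M1; move: c12; goal_lia.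
have [a12|a12] := leqP (a \in D1) (a \in D2).
  by have := ub2 _ _ _ ab aS bS M2; have := ub1 _ _ cS M1; move: a12; goal_lia.
have [c1 c2] : c \in D1 /\ c \notin D2 by move: c12; case: (c \in D1); case: (c \in D2).
have [a1 a2] : a \in D1 /\ a \notin D2 by move: a12; case: (a \in D1); case: (a \in D2).
have [x [x2 x1 M1' M2']] := lattice_path_exchange M1 M2 a1 a2.
have := cardI_exchange S a1 x1; have := cardI_exchange S x2 a2.
have cx : c != x by apply/eqP => cx; move: c2; rewrite cx x2.
have [bx|bx] := eqVneq b x.
  subst x.
  have := ub2 _ _ _ bc bS cS M1'; have := ub1 _ _ aS M2'.
  rewrite !inE !eqxx c1 (negbTE aS) (negbTE bS) (eq_sym c a) ac (eq_sym c b) (negbTE bc).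
  by rewrite x2 a1/=; goal_lia.
have := ub2 _ _ _ ab aS bS M2'; have := ub1 _ _ cS M1'.
rewrite !inE !eqxx c1 (negbTE aS) (negbTE cx) (eq_sym c a) ac bx (eq_sym b a) (negbTE ab).
by rewrite a1/=; goal_lia.
Qed.

Lemma rank_three_term (S : {set 'I_n}) (a b c : 'I_n) :
  a < b < c -> a \notin S -> b \notin S -> c \notin S ->
  rank M (a |: (c |: S)) + rank M (b |: S) =
  maxn (rank M (b |: (c |: S)) + rank M (a |: S))
       (rank M (a |: (b |: S)) + rank M (c |: S)).
Proof.
move=> abc aS bS cS; apply/eqP; rewrite eqn_leq; apply/andP; split.
  by apply: rank_middle_le => //; apply/eqP => e; move: abc; rewrite e; goal_lia.
rewrite geq_max rank_middle_ge ?abc//= (finset.setUCA [set a] [set c]).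
by rewrite (finset.setUCA [set a] [set b]) rank_middle_ge ?abc ?orbT.
Qed.
End Exchange.

Lemma card_ge_cnt n (D : {set 'I_n}) m :
  #|D :&: ~: [set j : 'I_n | j < m]| + cnt D m = #|D|.
Proof.
rewrite -[RHS]sum1_card (bigID (fun j : 'I_n => j < m))/= addnC.
congr (_ + _).
  by rewrite /cnt [RHS]big_mkcondr/=; apply: eq_bigr => j _; case: (j < m).
by rewrite -sum1_card; apply: eq_bigl => j; rewrite !inE.
Qed.

(** * The effect of raising on the rank function *)

Section Raise.
Variables (n : nat) (A B : {set 'I_n}) (i i' : 'I_n).
Hypotheses (AB : gale_le A B) (ii' : i' = i.+1 :> nat) (iB : i \in B) (i'B : i' \notin B).
Local Notation B' := (i' |: (B :\ i)).
Local Notation M := (lattice_path_matroid A B).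
Local Notation M' := (lattice_path_matroid A B').

Let cAB : #|A| = #|B|. Proof. by have /gale_leP[] := AB. Qed.
Let cAB' : #|A| = #|B'|. Proof. by rewrite card_exchange. Qed.

Let cntB' j : cnt B' j + (i < j) = cnt B j + (i' < j).
Proof. exact: cnt_exchange. Qed.

Lemma lattice_path_lower : A \in M.
Proof.
apply/(mem_lattice_path _ cAB); split=> // j.
by rewrite leqnn andbT; have /gale_leP[_] := AB.
Qed.

Lemma lattice_path_upper : B \in M.
Proof.
apply/(mem_lattice_path _ cAB); split=> [|j]; rewrite ?cAB// leqnn/=.
by have /gale_leP[_] := AB.
Qed.

Lemma lattice_path_raise_sub D : D \in M -> D \in M'.
Proof.
move=> /(mem_lattice_path _ cAB)[cD H]; apply/(mem_lattice_path _ cAB'); split=> // j.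
by have := H j; have := cntB' j; lia.
Qed.

(** The two lower bounds differ only at [i + 1], so [D] falls short of [B] exactly there. The bounds
    at [i] and [i + 2] then force [D] to step at [i'] and not at [i]. *)
Lemma lattice_path_raiseP D : D \in M' -> D \notin M ->
  [/\ i \notin D, i' \in D & i |: (D :\ i') \in M].
Proof.
move=> /(mem_lattice_path _ cAB')[cD H] DM.
have lt : cnt D i.+1 < cnt B i.+1.
  rewrite ltnNge; apply/negP => le; move/negP: DM; apply.
  apply/(mem_lattice_path _ cAB); split=> // j.
  have [->|ji] := eqVneq j i.+1; first by rewrite le; have /andP[] := H i.+1.
  by have := H j; have := cntB' j; lia.
have [iD i'D] : i \notin D /\ i' \in D.
  have := H i; have := H i'.+1; have := cntB' i'.+1; have := cntB' i; move: lt.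
  rewrite cntS (cntS B i') (cntS D i') (cntS B i) ii' (cntS B i) (cntS D i) iB (negbTE i'B).
  by clear -ii'; case: (i \in D); case: (i' \in D) => //; lia.
split=> //; apply/(mem_lattice_path _ cAB); split=> [|j]; first by rewrite card_exchange.
(* Moving [i'] back to [i] raises the count at [i + 1] to that of [B], which does not exceed that of
   [A]. *)
have := H j; have := cntB' j; have := cnt_exchange j i'D iD.
have /gale_leP[_ /(_ j)] := AB; move: lt ii'; have [->|/eqP] := eqVneq j i.+1; goal_lia.
Qed.

Lemma raise_mem D : D \in M -> i \in D -> i' \notin D -> i' |: (D :\ i) \in M'.
Proof.
move=> /(mem_lattice_path _ cAB)[cD H] iD i'D; apply/(mem_lattice_path _ cAB').
split=> [|j]; first by rewrite card_exchange.
by have := H j; have := cntB' j; have := cnt_exchange j iD i'D; lia.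
Qed.

Lemma rank_raise_sub S : rank M S <= rank M' S.
Proof. by apply/bigmax_leqP => D DM; rewrite rank_ub// lattice_path_raise_sub. Qed.

(** Replacing [i'] by [i] turns a new basis into an old one that meets [i |: T] equally well; the
    reverse move is [raise_mem]. *)
Lemma rank_raise (T : {set 'I_n}) : i \notin T -> i' \notin T ->
  rank M' (i' |: T) = maxn (rank M (i' |: T)) (rank M (i |: T)).
Proof.
move=> iT i'T; apply/eqP; rewrite eqn_leq; apply/andP; split.
  apply/bigmax_leqP => D DM'; have [DM|DM] := boolP (D \in M).
    by rewrite leq_max rank_ub.
  have [iD i'D DM1] := lattice_path_raiseP DM' DM.
  rewrite leq_max; apply/orP; right; apply: leq_trans (rank_ub _ DM1).
  have := cardI_exchange T i'D iD.
  by rewrite !cardIU1// !inE eqxx/= (negbTE iT) (negbTE i'T) i'D; goal_lia.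
rewrite geq_max rank_raise_sub/=; apply/bigmax_leqP => D DM.
have [/andP[iD i'D]|iD] := boolP ((i \in D) && (i' \notin D)).
  apply: leq_trans (rank_ub _ (raise_mem DM iD i'D)).
  have := cardI_exchange T iD i'D.
  by rewrite !cardIU1// !inE eqxx/= (negbTE iT) (negbTE i'T) iD; goal_lia.
apply: leq_trans (rank_ub _ (lattice_path_raise_sub DM)).
by rewrite !cardIU1// leq_add2r; move: iD; case: (i \in D); case: (i' \in D).
Qed.

(** For such [S], replacing [i'] by [i] in a new basis does not shrink its intersection with [S]. *)
Lemma rank_raise_id (S : {set 'I_n}) : ~~ ((i \notin S) && (i' \in S)) ->
  rank M' S = rank M S.
Proof.
move=> iS; apply/eqP; rewrite eqn_leq rank_raise_sub andbT.
apply/bigmax_leqP => D DM'; have [DM|DM] := boolP (D \in M); first exact: rank_ub.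
have [iD i'D DM1] := lattice_path_raiseP DM' DM.
apply: leq_trans (rank_ub _ DM1); have := cardI_exchange S i'D iD.
by move: iS; case: (i \in S); case: (i' \in S) => //= _; goal_lia.
Qed.

(** This makes the constant of the raising operator vanish. Both ranks are attained by [B], whose
    counts are least, and its two intersections differ by the element [i]. *)
Lemma rank_raise_const :
  rank M (~: (i' |: [set j : 'I_n | j < i])) = (rank M (~: [set j : 'I_n | j <= i])).+1.
Proof.
have E2 (D : {set 'I_n}) : #|D :&: ~: [set j : 'I_n | j <= i]| + cnt D i.+1 = #|D|.
  by rewrite -[RHS](card_ge_cnt D i.+1).
have E1 (D : {set 'I_n}) :
    (i' \in D) + #|D :&: ~: (i' |: [set j : 'I_n | j < i])| + cnt D i = #|D|.
  rewrite -[RHS](card_ge_cnt D i) -cardIU1 ?inE ?eqxx//.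
  congr (#|pred_of_set _| + _); apply/setP => j; rewrite !inE; congr (_ && _).
  by case: eqVneq => //= ->; rewrite ii' ltnNge leqnSn.
have -> : rank M (~: (i' |: [set j : 'I_n | j < i])) = #|A| - cnt B i.
  apply/eqP; rewrite eqn_leq; apply/andP; split; last first.
    apply: leq_trans (rank_ub _ lattice_path_upper).
    by have := E1 B; rewrite (negbTE i'B) cAB; goal_lia.
  apply/bigmax_leqP => D /(mem_lattice_path _ cAB)[cD H].
  by have := E1 D; have := H i; rewrite cD; goal_lia.
have -> : rank M (~: [set j : 'I_n | j <= i]) = #|A| - cnt B i.+1.
  apply/eqP; rewrite eqn_leq; apply/andP; split; last first.
    apply: leq_trans (rank_ub _ lattice_path_upper).
    by have := E2 B; rewrite cAB; goal_lia.
  apply/bigmax_leqP => D /(mem_lattice_path _ cAB)[cD H].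
  by have := E2 D; have := H i.+1; rewrite cD; goal_lia.
by have := E2 B; rewrite cAB cntS iB; goal_lia.
Qed.

End Raise.
End Combinatorics.

(** * Polytopes and generalized permutahedra *)

Section Polytopes.
Set Implicit Arguments.
Unset Strict Implicit.
Unset Printing Implicit Defensive.
Import Order.TTheory GRing.Theory Num.Theory.
Local Open Scope classical_set_scope.
Local Open Scope ring_scope.
Variable R : realType.

(** * Linear functionals and convex hulls *)

Definition dot n (w x : 'rV[R]_n) : R := \sum_j w 0 j * x 0 j.

Lemma dotC n (w x : 'rV[R]_n) : dot w x = dot x w.
Proof. by apply: eq_bigr => j _; rewrite mulrC. Qed.

Lemma dotDr n (w x y : 'rV[R]_n) : dot w (x + y) = dot w x + dot w y.
Proof. by rewrite /dot -big_split; apply: eq_bigr => j _; rewrite mxE mulrDr. Qed.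

Lemma dotZr n (w x : 'rV[R]_n) t : dot w (t *: x) = t * dot w x.
Proof. by rewrite /dot mulr_sumr; apply: eq_bigr => j _; rewrite mxE mulrCA. Qed.

Lemma dotBr n (w x y : 'rV[R]_n) : dot w (x - y) = dot w x - dot w y.
Proof. by rewrite -scaleN1r dotDr dotZr mulN1r. Qed.

Lemma dotDl n (w x y : 'rV[R]_n) : dot (w + x) y = dot w y + dot x y.
Proof. by rewrite dotC dotDr !(dotC y). Qed.

Lemma dotZl n (w x : 'rV[R]_n) t : dot (t *: w) x = t * dot w x.
Proof. by rewrite dotC dotZr dotC. Qed.

Lemma dot_gt0 n (x : 'rV[R]_n) : x != 0 -> 0 < dot x x.
Proof.
have ge0 j : 0 <= x 0 j * x 0 j by rewrite -expr2 sqr_ge0.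
move=> x0; rewrite lt_neqAle sumr_ge0 ?andbT => [|j _]; last exact: ge0.
apply: contraNneq x0 => /esym/eqP; rewrite psumr_eq0 => [/allP x0|j _]; last exact: ge0.
apply/eqP/rowP => j; rewrite mxE; apply/eqP; rewrite -[_ == _]orbb -mulf_eq0.
by apply: x0; rewrite mem_index_enum.
Qed.

Lemma dot_delta n (w : 'rV[R]_n) j : dot w (delta_mx 0 j) = w 0 j.
Proof.
rewrite /dot (bigD1 j)//= mxE !eqxx mulr1 big1 ?addr0// => k kj.
by rewrite mxE (negbTE kj) andbF mulr0.
Qed.

Lemma convex_setP n (C : set 'rV[R]_n) : convex_set C <->
  forall x y t, 0 <= t <= 1 -> C x -> C y -> C (t *: x + (1 - t) *: y).
Proof.
split=> [H x y t /andP[t0 t1] Cx Cy|H x y t].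
  by have := H x y (Itv01 t0 t1); rewrite !inE; apply.
by rewrite !inE => Cx Cy; apply: H => //; rewrite ge0 le1.
Qed.

Lemma conv_hull_convex n (X : set 'rV[R]_n) x y t : 0 <= t <= 1 ->
  conv_hull X x -> conv_hull X y -> conv_hull X (t *: x + (1 - t) *: y).
Proof.
move=> t01 Xx Xy C [cC XC]; move/convex_setP: (cC); apply=> //.
  by apply: Xx; split.
by apply: Xy; split.
Qed.

Lemma conv_hull_min n (X C : set 'rV[R]_n) :
  (forall x y t, 0 <= t <= 1 -> C x -> C y -> C (t *: x + (1 - t) *: y)) ->
  X `<=` C -> conv_hull X `<=` C.
Proof. by move=> /convex_setP cC XC; exact: smallest_sub. Qed.

Lemma conv_hull_gen n (X : set 'rV[R]_n) : X `<=` conv_hull X.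
Proof. exact: sub_gen_smallest. Qed.

Lemma conv_hull_sub n (X Y : set 'rV[R]_n) :
  X `<=` conv_hull Y -> conv_hull X `<=` conv_hull Y.
Proof. by apply: conv_hull_min => x y t; exact: conv_hull_convex. Qed.

(** The alternative is stable under convex combinations: a proper combination attains [m] only if
    both ends do. *)
Lemma conv_hull_face n (X : set 'rV[R]_n) w m : (forall x, X x -> dot w x <= m) ->
  forall x, conv_hull X x -> dot w x < m \/
    dot w x = m /\ conv_hull [set y | X y /\ dot w y = m] x.
Proof.
move=> Xm; apply: conv_hull_min => [x y t /andP[t0 t1] Hx Hy|x Xx]; last first.
  have := Xm _ Xx; rewrite le_eqVlt => /orP[/eqP e|]; last by left.
  by right; split=> //; apply: conv_hull_gen.
rewrite dotDr !dotZr.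
have [->|tn0] := eqVneq t 0.
  by rewrite scale0r add0r mul0r add0r subr0 scale1r mul1r.
have [->|tn1] := eqVneq t 1.
  by rewrite subrr scale0r addr0 mul0r addr0 scale1r mul1r.
have {tn0}t0' : 0 < t by rewrite lt_neqAle eq_sym tn0.
have {tn1}t1' : 0 < 1 - t by rewrite subr_gt0 lt_neqAle tn1.
have [xm|[xm Cx]] := Hx; have [ym|[ym Cy]] := Hy.
- by left; nra.
- by left; nra.
- by left; nra.
- by right; split; [rewrite xm ym; ring|apply: conv_hull_convex; rewrite ?t0].
Qed.

Lemma conv_hull_dot_le n (X : set 'rV[R]_n) w m : (forall x, X x -> dot w x <= m) ->
  forall x, conv_hull X x -> dot w x <= m.
Proof. by move=> Xm x /(conv_hull_face Xm)[/ltW//|[->]]. Qed.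

(** * Farkas' lemma and separation *)

Fixpoint cone n (s : seq 'rV[R]_n) (b : 'rV[R]_n) : Prop :=
  if s is a :: s' then exists2 l, 0 <= l & cone s' (b - l *: a) else b = 0.

(** The multiples of [a] add up to one nonnegative coefficient. In [farkas] this leads back from the
    projected vectors to the original ones. *)
Lemma cone_shear n (f : 'rV[R]_n -> R) (a : 'rV[R]_n) s b :
  (forall x, x \in s -> 0 <= f x) -> cone [seq x + f x *: a | x <- s] b ->
  exists2 l, 0 <= l & cone s (b - l *: a).
Proof.
elim: s b => [|x s IH] b sf /=; first by move=> ->; exists 0 => //=; rewrite scale0r subr0.
move=> [l l0 /IH[y ys|k k0 H]]; first by apply: sf; rewrite inE ys orbT.
have fx : 0 <= f x by apply: sf; rewrite mem_head.
exists (k + l * f x); first by rewrite addr_ge0// mulr_ge0.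
exists l => //; congr (cone s _): H.
by apply/rowP => j; rewrite !mxE; ring.
Qed.

(* Induction on the number of vectors: a functional violating the conclusion for
   the tail is used to project along the head. *)
Lemma farkas n (s : seq 'rV[R]_n) b :
  (forall w, (forall a, a \in s -> dot w a <= 0) -> dot w b <= 0) -> cone s b.
Proof.
move: {2}(size s) (leqnn (size s)) => m.
elim: m s b => [|m IH] [|a s] b //= sm H; try exact: IH.
- by apply/eqP/negPn/negP => /dot_gt0; rewrite ltNge H.
- by apply/eqP/negPn/negP => /dot_gt0; rewrite ltNge H.
have [H'|] := pselect (forall w, (forall x, x \in s -> dot w x <= 0) -> dot w b <= 0).
  by exists 0 => //; rewrite scale0r subr0; exact: IH.
move=> /existsNP[w /not_implyP[ws /negP]]; rewrite -ltNge => wb.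
have wa : 0 < dot w a.
  rewrite ltNge; apply/negP => wa; move: wb; rewrite ltNge => /negP; apply.
  by apply: H => x; rewrite inE => /orP[/eqP->//|/ws].
(* Adding [f x *: a] projects [x] along [a] onto the kernel of [dot w]; [f] is nonnegative on [s]
   because [w] is nonpositive there. *)
pose f x := - dot w x / dot w a.
have [||l l0 Hl] := @cone_shear _ f a s (b + f b *: a).
- by move=> x xs; rewrite /f divr_ge0 ?oppr_ge0 ?ws// ltW.
- apply: IH; first by rewrite size_map.
  (* [v] is [u] composed with this projection, hence vanishes on [a]. *)
  move=> u us; pose v := u - (dot u a / dot w a) *: w.
  have vE x : dot v x = dot u (x + f x *: a).
    by rewrite /v /f -scaleNr dotDl dotZl dotDr dotZr; field; rewrite gt_eqF.
  rewrite -vE; apply: H => x; rewrite inE => /orP[/eqP->|xs].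
    by rewrite vE /f mulNr divff ?gt_eqF// scaleN1r subrr -(scale0r a) dotZr mul0r.
  by rewrite vE; apply: us; apply: map_f.
exists (l - f b).
  by rewrite addr_ge0// /f mulNr opprK divr_ge0// ltW.
by congr (cone s _): Hl; apply/rowP => j; rewrite !mxE; ring.
Qed.

(** Homogenisation: at height [t > 0] the cone over the lifted points lies in [t] times the hull.
    Height zero is included because the tail of the list may carry no weight. *)
Lemma cone_conv_hull n (s : seq 'rV[R]_n) y (t : R) :
  cone [seq row_mx p (1%:M : 'M_1) | p <- s] (row_mx y t%:M) ->
  [/\ 0 <= t, t = 0 -> y = 0 & 0 < t -> conv_hull [set` s] (t^-1 *: y)].
Proof.
elim: s y t => [|p s IH] y t /=.
  rewrite -row_mx0 => /eq_row_mx[-> /(congr1 (fun M : 'M_1 => M 0 0))].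
  by rewrite !mxE eqxx mulr1n => ->; split=> //; rewrite ltxx.
move=> [l l0]; rewrite scale_row_mx opp_row_mx add_row_mx scale_scalar_mx mulr1 -raddfB.
move=> /IH[tl0 tl1 tl2]; rewrite subr_ge0 in tl0.
have sub : [set` s] `<=` conv_hull [set` (p :: s)].
  by move=> q qs; apply: conv_hull_gen; rewrite /= inE; apply/orP; right.
have ps : conv_hull [set` (p :: s)] p by apply: conv_hull_gen; rewrite /= mem_head.
split; first exact: le_trans tl0.
  move=> t0; have l_0 : l = 0 by apply/eqP; rewrite eq_le l0 andbT -t0.
  by have := tl1; rewrite t0 l_0 scale0r !subr0; apply.
move=> t0; have [tl|tl] := eqVneq t l.
  have /eqP : y - l *: p = 0 by apply: tl1; rewrite tl subrr.
  by rewrite subr_eq0 => /eqP->; rewrite -tl scalerA mulVf ?gt_eqF// scale1r.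
have tl' : 0 < t - l by rewrite subr_gt0 lt_neqAle eq_sym tl.
have -> : t^-1 *: y = (l / t) *: p + (1 - l / t) *: ((t - l)^-1 *: (y - l *: p)).
  by apply/rowP => j; rewrite !mxE; field; rewrite !gt_eqF.
apply: conv_hull_convex => //.
  by rewrite divr_ge0 ?(ltW t0)//= ler_pdivrMr// mul1r.
by apply: conv_hull_sub (tl2 tl') => q /sub.
Qed.

(** Farkas' lemma is applied to the lifted points; the last coordinate of the functional is an
    additive constant and cancels when [p] and [x] are compared. *)
Lemma conv_hull_separation n (s : seq 'rV[R]_n) x : ~ conv_hull [set` s] x ->
  exists w, forall p, p \in s -> dot w p < dot w x.
Proof.
move=> sx; apply: contrapT => nosep; apply: sx.
have [_ _ /(_ ltr01)] : [/\ 0 <= 1 :> R, 1 = 0 :> R -> x = 0 &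
    0 < 1 :> R -> conv_hull [set` s] (1^-1 *: x)].
  apply: cone_conv_hull; apply: farkas => w ws.
  rewrite leNgt; apply/negP => wx; apply: nosep; exists (lsubmx w) => p ps.
  have dotE (z : 'rV[R]_n) : dot w (row_mx z 1%:M) = dot (lsubmx w) z + w 0 (rshift n 0).
    rewrite /dot big_split_ord big_ord1; congr (_ + _).
      by apply: eq_bigr => j _; rewrite row_mxEl mxE.
    by rewrite row_mxEr mxE mulr1.
  have := ws _ (map_f _ ps); move: wx; rewrite !dotE => wx wp.
  by rewrite -(ltrD2r (w 0 (rshift n 0))); exact: le_lt_trans wx.
by rewrite invr1 scale1r.
Qed.


(** * Generic functionals and edges *)

Lemma seq_argmax (T : eqType) (f : T -> R) (s : seq T) : s != [::] ->
  exists2 x, x \in s & forall y, y \in s -> f y <= f x.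
Proof.
elim: s => //= a [_ _|b s /(_ isT)[x xs xmax] _].
  by exists a; rewrite ?mem_head// => y; rewrite inE => /eqP->.
have [ax|xa] := leP (f a) (f x).
  by exists x; [rewrite inE xs orbT|move=> y; rewrite inE => /orP[/eqP->|/xmax]].
exists a; first by rewrite mem_head.
by move=> y; rewrite inE => /orP[/eqP->//|/xmax/le_trans]; apply; exact: ltW.
Qed.

Lemma perturb_pos n (N : seq 'rV[R]_n) w y : (forall x, x \in N -> 0 < dot w x) ->
  exists2 e, 0 < e & forall x, x \in N -> 0 < dot (w + e *: y) x.
Proof.
(* Asking for all [d] up to [e] lets the induction take a minimum of bounds. *)
suff H : (forall x, x \in N -> 0 < dot w x) -> exists2 e, 0 < e &
    forall d, 0 < d <= e -> forall x, x \in N -> 0 < dot (w + d *: y) x.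
  by move/H => [e e0 He]; exists e => // x; apply: He; rewrite e0 lexx.
elim: N => [_|x N IH wN]; first by exists 1.
have [z zN|e e0 He] := IH; first by apply: wN; rewrite inE zN orbT.
have wx : 0 < dot w x by apply: wN; rewrite mem_head.
have c0 : 0 < 1 + `|dot y x| by rewrite ltr_pwDl.
(* The summand 1 keeps the denominator positive and the resulting inequality strict. *)
exists (Num.min e (dot w x / (1 + `|dot y x|))).
  by rewrite lt_min e0 divr_gt0.
move=> d; rewrite le_min => /and3P[d0 de]; rewrite ler_pdivlMr// => dx z.
rewrite inE => /orP[/eqP->|]; last by apply: He; rewrite d0.
rewrite dotDl dotZl; have := ler_norm (- dot y x); rewrite normrN => yx.
nra.
Qed.

Lemma perturb_generic n (N L : seq 'rV[R]_n) w :
  (forall x, x \in N -> 0 < dot w x) ->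
  exists w', (forall x, x \in N -> 0 < dot w' x) /\
    (forall y, y \in L -> y != 0 -> dot w' y != 0).
Proof.
move=> wN; elim: L => [|y L [w' [w'N w'L]]]; first by exists w.
have [y0|y0] := eqVneq y 0.
  by exists w'; split=> // z; rewrite inE => /orP[/eqP->|/w'L//]; rewrite y0 eqxx.
have [wy|wy] := eqVneq (dot w' y) 0; last first.
  by exists w'; split=> // z; rewrite inE => /orP[/eqP->|/w'L].
(* A nonzero value at [z] is a positive value at [dot w' z *: z], so keeping positivity also keeps
   nonvanishing. Adding a multiple of [y] itself makes the value at [y] nonzero. *)
pose L' := [seq dot w' z *: z | z <- L & z != 0].
have [|e e0 He] := @perturb_pos _ (N ++ L') w' y.
  move=> x; rewrite mem_cat => /orP[/w'N//|/mapP[z]].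
  rewrite mem_filter => /andP[z0 zL] ->.
  by rewrite dotZr -expr2 exprn_even_gt0// w'L.
exists (w' + e *: y); split=> [x xN|z].
  by apply: He; rewrite mem_cat xN.
rewrite inE => /orP[/eqP-> _|zL z0].
  by rewrite dotDl dotZl wy add0r mulf_neq0 ?gt_eqF// dot_gt0.
have : 0 < dot (w' + e *: y) (dot w' z *: z).
  apply: He; rewrite mem_cat; apply/orP; right.
  by apply: (map_f (fun z => dot w' z *: z)); rewrite mem_filter z0.
by apply: contraTneq => z'; rewrite dotZr z' mulr0 ltxx.
Qed.

(* Among the directions out of the unique [w]-maximal point [v], normalised by
   their decrease of [w], the [u]-largest one spans an edge. *)
Lemma improving_edge n (s : seq 'rV[R]_n) (w u v : 'rV[R]_n) :
  let q p := (dot w v - dot w p)^-1 *: (p - v) in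
  v \in s -> (forall p, p \in s -> p != v -> dot w p < dot w v) ->
  (forall p p', p \in s -> p' \in s -> q p != q p' -> dot u (q p) != dot u (q p')) ->
  (exists2 p, p \in s & dot u v < dot u p) ->
  exists p, [/\ p \in s, edge (conv_hull [set` s]) v p & dot u v < dot u p].
Proof.
move=> q vs wmax uq [p1 p1s up1].
pose D p := dot w v - dot w p.
have D0 p : p \in s -> p != v -> 0 < D p by move=> ps pv; rewrite subr_gt0 wmax.
have qE p : p \in s -> p - v = D p *: q p.
  move=> ps; have [->|pv] := eqVneq p v; first by rewrite /D !subrr scale0r.
  by rewrite scalerA divff ?scale1r// gt_eqF// D0.
have p1v : p1 != v by apply: contraTneq up1 => ->; rewrite ltxx.
have p1f : p1 \in [seq p <- s | p != v] by rewrite mem_filter p1v.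
have [|p0] := @seq_argmax _ (fun p => dot u (q p)) [seq p <- s | p != v].
  by apply: contraTneq p1f => ->.
rewrite mem_filter => /andP[p0v p0s] p0max.
have p0f : p0 \in [seq p <- s | (p != v) && (q p == q p0)].
  by rewrite mem_filter p0v eqxx.
(* Several points may lie in the best direction; the one with the largest [D] is the far end of the
   edge. *)
have [|p2] := @seq_argmax _ D [seq p <- s | (p != v) && (q p == q p0)].
  by apply: contraTneq p0f => ->.
rewrite mem_filter => /andP[/andP[p2v /eqP p2q] p2s] p2max.
have {p1f}m0 : 0 < dot u (q p0).
  apply: lt_le_trans (p0max _ p1f); rewrite dotZr mulr_gt0//.
    by rewrite invr_gt0 D0.
  by rewrite dotBr subr_gt0.
exists p2; split=> //; last first.
  by rewrite -subr_gt0 -dotBr qE// dotZr p2q mulr_gt0// D0.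
split; first by rewrite eq_sym.
(* [f] is constant along the best direction and decreases along all others, so it exposes the
   edge. *)
pose f := u + dot u (q p0) *: w.
have fE p : p \in s -> dot f p = dot f v + D p * (dot u (q p) - dot u (q p0)).
  move=> ps; have := congr1 (dot u) (qE p ps); rewrite dotBr dotZr => e.
  by rewrite /f !dotDl !dotZl mulrBr -e /D; ring.
have fle p : p \in s -> dot f p <= dot f v.
  move=> ps; rewrite fE// gerDl; have [->|pv] := eqVneq p v.
    by rewrite /D subrr mul0r.
  rewrite mulr_ge0_le0 ?(ltW (D0 _ _ _))// subr_le0 p0max//.
  by rewrite mem_filter pv.
have ss : [set v; p2] `<=` [set` s] by move=> x [->|->].
exists f; apply/seteqP; split=> x.
- move=> x2; split.
    by apply: conv_hull_sub x2 => y /ss; exact: conv_hull_gen.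
  have -> : \sum_j f 0 j * x 0 j = dot f v; last exact: conv_hull_dot_le.
  move: x x2; apply: conv_hull_min => [x y t _ xf yf|x].
    by rewrite -/(dot _ _) dotDr !dotZr [dot f x]xf [dot f y]yf; ring.
  by move=> [->//|->]; rewrite -/(dot _ _) fE// p2q subrr mulr0 addr0.
- move=> [xs /(_ v (conv_hull_gen vs)) xf].
  have [|[_]] := conv_hull_face fle xs; first by rewrite ltNge xf.
  apply: conv_hull_sub => p [ps]; rewrite fE// -[RHS]addr0 => /addrI/eqP.
  have [-> _|pv] := eqVneq p v; first by apply: conv_hull_gen; left.
  rewrite mulf_eq0 gt_eqF ?D0//= subr_eq0 => /eqP upq.
  have pq : q p = q p0.
    by apply/eqP; apply: contra_eqT upq => pq; exact: uq.
  have -> : p = (D p / D p2) *: p2 + (1 - D p / D p2) *: v.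
    have -> : (D p / D p2) *: p2 + (1 - D p / D p2) *: v = (D p / D p2) *: (p2 - v) + v.
      by apply/rowP => j; rewrite !mxE; ring.
    rewrite (qE p2)// p2q scalerA divfK ?gt_eqF ?D0//.
    by rewrite -pq -qE// subrK.
  apply: conv_hull_convex; last 2 first.
  - by apply: conv_hull_gen; right.
  - by apply: conv_hull_gen; left.
  have Dp := D0 _ ps pv; have Dp2 := D0 _ p2s p2v.
  rewrite divr_ge0 ?(ltW Dp) ?(ltW Dp2)//= ler_pdivrMr// mul1r p2max//.
  by rewrite mem_filter pv pq eqxx.
Qed.


(** * Generalized permutahedra and their submodular functions *)

Definition separates n (s : seq 'rV[R]_n) (w : 'rV[R]_n) : Prop :=
  {in s &, injective (dot w)}.

Lemma perturb_separates n (N : seq 'rV[R]_n) (ss : seq (seq 'rV[R]_n)) w :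
  (forall x, x \in N -> 0 < dot w x) ->
  exists w', (forall x, x \in N -> 0 < dot w' x) /\
    (forall s, s \in ss -> separates s w').
Proof.
move=> /(@perturb_generic _ N
  (flatten [seq [seq x - y | x <- s, y <- s] | s <- ss]))[w' [w'N w'L]].
exists w'; split=> // s sss x y xs ys xy; apply/eqP; rewrite -subr_eq0.
apply: contraPT (congr1 (fun z => z == dot w' y) xy) => xy0.
rewrite eqxx -subr_eq0 -dotBr (negbTE (w'L _ _ xy0))//.
by apply/flattenP; exists [seq x - y | x <- s, y <- s]; [exact: map_f|exact: allpairs_f].
Qed.

Lemma dot_sum n (S : {set 'I_n}) (x : 'rV[R]_n) :
  \sum_(j in S) x 0 j = dot (\row_j (j \in S)%:R) x.
Proof.
rewrite big_mkcond; apply: eq_bigr => j _; rewrite mxE.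
by case: (j \in S); rewrite ?mul1r ?mul0r.
Qed.

Lemma greedy n (s : seq 'rV[R]_n) (w v : 'rV[R]_n) (S : {set 'I_n}) :
  generalized_permutahedron (conv_hull [set` s]) ->
  v \in s -> (forall p, p \in s -> p != v -> dot w p < dot w v) ->
  (forall a b, a \in S -> w 0 a < w 0 b -> b \in S) ->
  forall p, p \in s -> \sum_(j in S) p 0 j <= \sum_(j in S) v 0 j.
Proof.
move=> [_ edges] vs wmax wS p ps; rewrite leNgt; apply/negP.
rewrite !dot_sum => vp.
(* The indicator of [S] is only weakly increasing for the order induced by [w]; adding [e *: w]
   makes it strictly so, while [p] still beats [v]. *)
have [|e e0 He] := @perturb_pos _ [:: p - v] (\row_j (j \in S)%:R) w.
  by move=> x; rewrite inE => /eqP->; rewrite dotBr subr_gt0.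
pose N := (p - v) :: [seq delta_mx 0 ab.2 - delta_mx 0 ab.1 |
                       ab <- enum {: 'I_n * 'I_n} & w 0 ab.1 < w 0 ab.2].
pose q p := (dot w v - dot w p)^-1 *: (p - v).
have [|u [uN uq]] := @perturb_separates _ N [:: map q s]
    ((\row_j (j \in S)%:R) + e *: w).
  move=> x; rewrite inE => /orP[/eqP->|/mapP[[a b]]].
    by apply: He; rewrite mem_head.
  rewrite mem_filter /= => /andP[ab _] ->.
  rewrite dotBr !dot_delta !mxE subr_gt0 ler_ltD ?ltr_pM2l//.
  by have := wS a b; case: (a \in S) => [/(_ isT ab)->|_]; rewrite ?ler_nat.
have [||p' [p's vp' up']] := @improving_edge _ s w u v vs wmax.
- move=> p1 p2 p1s p2s; apply: contraNneq => u12; apply/eqP.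
  by apply: (uq (map q s)) u12; rewrite ?mem_head ?(map_f q).
- by exists p => //; rewrite -subr_gt0 -dotBr uN// mem_head.
have [a [b [t [ab vpE]]]] := edges _ _ vp'.
have := wmax _ p's; rewrite eq_sym; case: (vp') => -> _ /(_ isT).
rewrite -subr_lt0 -dotBr vpE dotZr dotBr !dot_delta.
move: up'; rewrite -subr_gt0 -dotBr vpE dotZr dotBr !dot_delta.
have uw c d : w 0 c < w 0 d -> u 0 c < u 0 d.
  move=> wcd; rewrite -subr_gt0 -!dot_delta -dotBr; apply: uN.
  rewrite inE; apply/orP; right; apply/mapP; exists (c, d) => //.
  by rewrite mem_filter wcd mem_enum.
(* On the edge direction [u] and [w] have the same sign, yet [u] increases and [w] decreases. *)
case: (ltgtP (w 0 a) (w 0 b)) => [wab|wab|->]; last by rewrite subrr mulr0 ltxx.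
- have := uw _ _ wab => uab ut wt; nra.
- have := uw _ _ wab => uab ut wt; nra.
Qed.

Lemma submod_max n (P : set 'rV[R]_n) (S : {set 'I_n}) v : P v ->
  (forall x, P x -> \sum_(j in S) x 0 j <= \sum_(j in S) v 0 j) ->
  submod P S = \sum_(j in S) v 0 j.
Proof.
move=> Pv vmax; have ub : ubound [set \sum_(j in S) x 0 j | x in P] (\sum_(j in S) v 0 j).
  by move=> _ [x Px <-]; exact: vmax.
apply/eqP; rewrite eq_le; apply/andP; split.
  by apply: ge_sup ub; exists (\sum_(j in S) v 0 j); exists v.
by apply: ub_le_sup; [exists (\sum_(j in S) v 0 j)|exists v].
Qed.

Lemma submod_conv_hull n (X : set 'rV[R]_n) (S : {set 'I_n}) v : X v ->
  (forall x, X x -> \sum_(j in S) x 0 j <= \sum_(j in S) v 0 j) ->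
  submod (conv_hull X) S = \sum_(j in S) v 0 j.
Proof.
move=> Xv vmax; apply: submod_max => [|x]; first exact: conv_hull_gen.
rewrite dot_sum; apply: conv_hull_dot_le => y Xy; rewrite -dot_sum; exact: vmax.
Qed.

(** The two upper sets differ only in [j], and [v] attains both maxima by [greedy]. *)
Lemma greedy_coord n (s : seq 'rV[R]_n) (w v : 'rV[R]_n) :
  generalized_permutahedron (conv_hull [set` s]) ->
  v \in s -> (forall p, p \in s -> p != v -> dot w p < dot w v) ->
  injective (w 0) ->
  forall j, v 0 j = submod (conv_hull [set` s]) [set k | w 0 j <= w 0 k]%SET -
                    submod (conv_hull [set` s]) [set k | w 0 j < w 0 k]%SET.
Proof.
move=> gp vs wmax winj j.
have H := greedy gp vs wmax.
rewrite !(@submod_conv_hull _ _ _ v)//; last 2 first.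
- move=> x xs; apply: H xs => a b; rewrite !inE; exact: lt_trans.
- move=> x xs; apply: H xs => a b; rewrite !inE => ja ab; exact: (le_trans ja (ltW ab)).
rewrite (bigD1 j) ?inE//= -addrA -[LHS]addr0; congr (_ + _); apply/esym/eqP.
rewrite subr_eq0; apply/eqP; apply: eq_bigl => k; rewrite !inE lt_neqAle andbC.
by rewrite (inj_eq winj) eq_sym.
Qed.

Lemma submod_sub n (P Q : set 'rV[R]_n) : generalized_permutahedron P ->
  generalized_permutahedron Q -> submod P =1 submod Q -> P `<=` Q.
Proof.
move=> gP gQ PQ x Px; apply: contrapT => Qx.
have [[s1 [s10 P_E]] _] := gP; have [[s2 [s20 Q_E]] _] := gQ; subst P Q.
have [w0 w0s] := conv_hull_separation Qx.
(* Genericity makes the maximal points of [s1] and [s2] unique and, through the standard basis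
   vectors, the coordinates of [w] distinct. *)
have [|w [wx wsep]] := @perturb_separates _ [seq x - p | p <- s2]
    [:: s1; s2; [seq delta_mx 0 j | j <- enum 'I_n]] w0.
  by move=> y /mapP[p ps ->]; rewrite dotBr subr_gt0 w0s.
have winj : injective (w 0).
  move=> a b ab; have /rowP/(_ a) : delta_mx 0 a = delta_mx 0 b :> 'rV[R]_n.
    apply: (wsep [seq delta_mx 0 j | j <- enum 'I_n]); rewrite ?inE ?eqxx ?orbT//.
    - by apply: map_f; rewrite mem_enum.
    - by apply: map_f; rewrite mem_enum.
    - by rewrite !dot_delta.
  by rewrite !mxE !eqxx/=; case: eqVneq => // _ /eqP; rewrite oner_eq0.
have umax s (v : 'rV[R]_n) : separates s w -> v \in s ->
    (forall p, p \in s -> dot w p <= dot w v) ->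
    forall p, p \in s -> p != v -> dot w p < dot w v.
  move=> sep vs vmax p ps pv; rewrite lt_neqAle vmax// andbT.
  by apply: contra_neq pv; exact: sep.
have [v1 v1s v1max] := seq_argmax (dot w) s10.
have [v2 v2s v2max] := seq_argmax (dot w) s20.
have v12 : v1 = v2.
  apply/rowP => j.
  rewrite (greedy_coord gP v1s (umax _ _ (wsep s1 _) v1s v1max) winj) ?mem_head//.
  rewrite (greedy_coord gQ v2s (umax _ _ (wsep s2 _) v2s v2max) winj) ?inE ?eqxx ?orbT//.
  by rewrite !PQ.
have : dot w x <= dot w v1 by apply: conv_hull_dot_le Px => y /v1max.
by rewrite v12 leNgt -subr_gt0 -dotBr wx// (map_f (fun p => x - p)).
Qed.

Lemma submod_inj n (P Q : set 'rV[R]_n) : generalized_permutahedron P ->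
  generalized_permutahedron Q -> submod P =1 submod Q -> P = Q.
Proof.
by move=> gP gQ PQ; apply/seteqP; split; apply: submod_sub => // S; rewrite PQ.
Qed.

End Polytopes.

(** * Matroid polytopes *)

Section MatroidPolytopes.
Set Implicit Arguments.
Unset Strict Implicit.
Unset Printing Implicit Defensive.
Import Order.TTheory GRing.Theory Num.Theory.
Local Open Scope classical_set_scope.
Local Open Scope ring_scope.
Variable R : realType.

Lemma indicator_vecE n (D : {set 'I_n}) j : indicator_vec R D 0 j = (j \in D)%:R.
Proof.
rewrite /indicator_vec summxE; have [jD|jD] := boolP (j \in D).
  rewrite (bigD1 j)//= mxE !eqxx big1 ?addr0// => k /andP[_ kj].
  by rewrite mxE eq_sym (negbTE kj) andbF.
rewrite big1// => k kD; rewrite mxE eqxx/=; case: eqVneq => // jk.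
by move: jD; rewrite jk kD.
Qed.

Lemma sum_indicator_vec n (D S : {set 'I_n}) :
  \sum_(j in S) indicator_vec R D 0 j = #|D :&: S|%:R.
Proof.
rewrite -sum1_card natr_sum big_mkcond [RHS]big_mkcond; apply: eq_bigr => j _.
by rewrite indicator_vecE inE; case: (j \in D); case: (j \in S).
Qed.

Lemma submod_matroid_polytope n (M : {set {set 'I_n}}) (S : {set 'I_n}) :
  M != finset.set0 -> submod (matroid_polytope R M) S = (rank M S)%:R.
Proof.
move=> M0; have [D DM DE] := rank_attained S M0.
rewrite -DE -sum_indicator_vec; apply: submod_conv_hull; first by exists D.
by move=> _ [E EM ->]; rewrite !sum_indicator_vec ler_nat DE rank_ub.
Qed.

Lemma matroid_polytope_seq n (M : {set {set 'I_n}}) :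
  matroid_polytope R M = conv_hull [set` [seq indicator_vec R D | D <- enum M]].
Proof.
congr conv_hull; apply/seteqP; split=> x /=.
  by move=> [D DM ->]; apply: map_f; rewrite mem_enum.
by move=> /mapP[D]; rewrite mem_enum => DM ->; exists D.
Qed.

(** A nonempty face is spanned by the indicator vectors it contains; the point [x] supplies the
    maximal value [m]. *)
Lemma matroid_polytope_face n (M : {set {set 'I_n}}) (F : set 'rV[R]_n) x :
  face (matroid_polytope R M) F -> F x ->
  exists w m, [/\ forall D, D \in M -> dot w (indicator_vec R D) <= m,
    forall D, D \in M -> F (indicator_vec R D) <-> dot w (indicator_vec R D) = m &
    F `<=` conv_hull [set y | exists2 D, D \in M & y = indicator_vec R D /\ F y]].
Proof.
move=> [w FE] Fx; exists w, (dot w x).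
have max y : matroid_polytope R M y -> dot w y <= dot w x.
  by move: y; move: Fx; rewrite FE => -[].
have Mx : matroid_polytope R M x by move: Fx; rewrite FE => -[].
have gen D : D \in M -> matroid_polytope R M (indicator_vec R D).
  by move=> DM; apply: conv_hull_gen; exists D.
have FD D : D \in M -> F (indicator_vec R D) <-> dot w (indicator_vec R D) = dot w x.
  move=> DM; split=> [|wD].
    rewrite FE => -[_ /(_ _ Mx) le].
    by apply/eqP; rewrite eq_le; apply/andP; split; [exact: (max _ (gen _ DM))|exact: le].
  by rewrite FE; split; [exact: gen|move=> y /max; rewrite -wD].
split=> // [D DM|y]; first exact: (max _ (gen _ DM)).
move=> Fy; have [My wy] : matroid_polytope R M y /\ dot w y = dot w x.
  move: (Fy); rewrite FE => -[My /(_ _ Mx) le]; split=> //.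
  by apply/eqP; rewrite eq_le; apply/andP; split; [exact: max|exact: le].
have : forall z, [set z | exists2 D, D \in M & z = indicator_vec R D] z ->
    dot w z <= dot w x.
  by move=> _ [D DM ->]; exact: (max _ (gen _ DM)).
move=> /conv_hull_face/(_ _ My)[|[_]]; first by rewrite wy ltxx.
apply: conv_hull_sub => _ [[D DM ->] wD]; apply: conv_hull_gen.
by exists D => //; split=> //; apply/FD.
Qed.

Lemma conv_hull_set1 n (v x : 'rV[R]_n) : conv_hull [set v] x -> x = v.
Proof.
move: x; apply: conv_hull_min => // x y t _ -> ->.
by rewrite -scalerDl addrCA subrr addr0 scale1r.
Qed.

Lemma conv_hull_set0 n (x : 'rV[R]_n) : ~ conv_hull set0 x.
Proof. by move: x; apply: (@conv_hull_min _ _ _ (fun _ => False)). Qed.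

Lemma matroid_polytope_vertex n (M : {set {set 'I_n}}) v :
  vertex (matroid_polytope R M) v -> exists2 D, D \in M & v = indicator_vec R D.
Proof.
move=> vM; have [w [m [_ _ /(_ v erefl) Fv]]] :=
  matroid_polytope_face vM (erefl : [set v] v).
apply: contrapT => NM; apply: (@conv_hull_set0 _ v).
by apply: conv_hull_sub Fv => _ [D DM [-> Dv]]; case: NM; exists D.
Qed.

Lemma conv_hull_pair n (u v x : 'rV[R]_n) : conv_hull [set u; v] x ->
  exists t, x = u + t *: (v - u).
Proof.
move: x; apply: conv_hull_min => [_ _ t _ [a ->] [b ->]|x [->|->]].
- by exists (t * a + (1 - t) * b); apply/rowP => j; rewrite !mxE; ring.
- by exists 0; rewrite scale0r addr0.
- by exists 1; rewrite scale1r addrC subrK.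
Qed.

Lemma indicator_vec_exchange n (D : {set 'I_n}) (c x : 'I_n) : c \in D -> x \notin D ->
  indicator_vec R (x |: (D :\ c))%SET =
  indicator_vec R D + (delta_mx 0 x - delta_mx 0 c).
Proof.
move=> cD xD; rewrite /indicator_vec big_setU1 ?inE ?negb_and ?xD ?orbT//=.
by rewrite [in RHS](big_setD1 c cD)/= [RHS]addrC addrA subrK.
Qed.

(* Symmetric exchange keeps the sum of the two weights, so it stays inside the
   edge; its direction is [e_x - e_c]. *)
Lemma matroid_polytope_edge n (M : {set {set 'I_n}}) :
  (forall D1 D2 : {set 'I_n}, D1 \in M -> D2 \in M -> #|D1| = #|D2|) ->
  (forall (D1 D2 : {set 'I_n}) c, D1 \in M -> D2 \in M -> c \in D1 -> c \notin D2 ->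
     exists x, [/\ x \in D2, x \notin D1, x |: (D1 :\ c) \in M &
       c |: (D2 :\ x) \in M]%SET) ->
  forall u v, edge (matroid_polytope R M) u v ->
  exists a b t, a != b /\ v - u = t *: (delta_mx 0 a - delta_mx 0 b).
Proof.
move=> Mcard Mexch u v [uv Fuv].
have Fu : conv_hull [set u; v] u by apply: conv_hull_gen; left.
have Fv : conv_hull [set u; v] v by apply: conv_hull_gen; right.
have [w [m [Mle MF Fsub]]] := matroid_polytope_face Fuv Fu.
have [D1 M1 F1] : exists2 D, D \in M & conv_hull [set u; v] (indicator_vec R D).
  apply: contrapT => NM; apply: (@conv_hull_set0 _ u).
  by apply: conv_hull_sub (Fsub _ Fu) => _ [D DM [-> DF]]; case: NM; exists D.
(* With a single basis on the face, the edge would collapse to a point. *)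
have [D2 [M2 F2 D12]] : exists D, [/\ D \in M,
    conv_hull [set u; v] (indicator_vec R D) & D != D1].
  apply: contrapT => NM; move/eqP: uv; apply.
  have eq1 x : conv_hull [set u; v] x -> x = indicator_vec R D1.
    move=> /Fsub Fx; apply: conv_hull_set1; apply: conv_hull_sub Fx.
    move=> _ [D DM [-> DF]]; apply: conv_hull_gen.
    by have [->//|DD1] := eqVneq D D1; case: NM; exists D.
  by rewrite (eq1 u Fu) (eq1 v Fv).
have [c c1 c2] : exists2 c, c \in D1 & c \notin D2.
  apply/fintype.subsetPn; apply: contraNN D12 => D12.
  by rewrite eq_sym eqEcard D12/= (Mcard _ _ M1 M2).
have [x [x2 x1 M1' M2']] := Mexch _ _ _ M1 M2 c1 c2.
have xc : x != c by apply: contraNneq x1 => ->.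
have F1' : conv_hull [set u; v] (indicator_vec R (x |: (D1 :\ c))%SET).
  apply/MF => //; apply/eqP; rewrite eq_le Mle//=.
  have := Mle _ M2'; move/MF : F2 => /(_ M2); move/MF : F1 => /(_ M1).
  by rewrite !indicator_vec_exchange// !(dotDr _ (indicator_vec _ _)) !dotBr => -> ->; lra.
have [t1 e1] := conv_hull_pair F1; have [t2 e2] := conv_hull_pair F1'.
have e : delta_mx 0 x - delta_mx 0 c = (t2 - t1) *: (v - u).
  move: e2; rewrite indicator_vec_exchange// e1 -addrA => /addrI/eqP.
  by rewrite addrC eq_sym -subr_eq -scalerBl => /eqP.
have t12 : t2 - t1 != 0.
  apply: contraTneq xc => t0; move: e; rewrite t0 scale0r => /rowP/(_ x).
  by rewrite !mxE !eqxx/=; case: eqVneq => // _ /eqP; rewrite subr0 oner_eq0.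
by exists x, c, (t2 - t1)^-1; split=> //; rewrite e scalerA mulVf// scale1r.
Qed.

(** Applied to the upper bound [B'], this makes the claimed result a candidate in the definition of
    [raising]. *)
Lemma lattice_path_MV n (A B : {set 'I_n}) : gale_le A B ->
  MV_polytope (matroid_polytope R (lattice_path_matroid A B)).
Proof.
move=> AB; have [cAB _] := (gale_leP A B).1 AB.
have M0 : lattice_path_matroid A B != finset.set0.
  by apply/finset.set0Pn; exists A; exact: lattice_path_lower.
split; last first.
  move=> S a b c abc aS bS cS /=; rewrite !submod_matroid_polytope// -!natrD.
  by rewrite rank_three_term// -natr_max.
split; last first.
  move=> v /matroid_polytope_vertex[D _ ->] j.
  by rewrite indicator_vecE; case: (j \in D); rewrite ?rpred1 ?rpred0.
split; last first.
  apply: matroid_polytope_edge => [D1 D2|D1 D2 c]; first exact: lattice_path_card.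
  exact: lattice_path_exchange.
exists [seq indicator_vec R D | D <- enum (lattice_path_matroid A B)].
split; last exact: matroid_polytope_seq.
have /finset.set0Pn[D DM] := M0.
have : indicator_vec R D \in
    [seq indicator_vec R D | D <- enum (lattice_path_matroid A B)].
  by apply: map_f; rewrite mem_enum.
by apply: contraTneq => ->.
Qed.

Lemma submod_raise n (A B : {set 'I_n}) (i i' : 'I_n) (S : {set 'I_n}) :
  gale_le A B -> i' = i.+1 :> nat -> i \in B -> i' \notin B ->
  submod (matroid_polytope R (lattice_path_matroid A (i' |: (B :\ i))%SET)) S =
  raise_submod i i' (submod (matroid_polytope R (lattice_path_matroid A B))) S.
Proof.
move=> AB ii' iB i'B; have AM := lattice_path_lower AB.
have AM' := lattice_path_raise_sub AB ii' iB i'B AM.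
rewrite /raise_submod /raise_const !submod_matroid_polytope;
  try by apply/finset.set0Pn; exists A.
case: ifPn => [/andP[iS i'S]|iS]; last by rewrite rank_raise_id.
rewrite (rank_raise_const AB ii' iB i'B) -natr1 addrAC addrK subrr subr0 -natr_max.
have := rank_raise AB ii' iB i'B (T := S :\ i').
by rewrite !inE eqxx finset.setD1K// (negbTE iS) andbF => ->.
Qed.

End MatroidPolytopes.

Theorem proposition4p4 (R : realType) (n k : nat) (A B : {set 'I_n})
    (i i' : 'I_n) (hA : #|A| = k) (hB : #|B| = k) (hAB : gale_le A B)
    (hi' : nat_of_ord i' = (nat_of_ord i).+1)
    (hiB : i \in B) (hi'B : i' \notin B)
    (hMV : MV_polytope (matroid_polytope R (lattice_path_matroid A B))) :
  raising i i' (matroid_polytope R (lattice_path_matroid A B)) =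
  matroid_polytope R (lattice_path_matroid A (i' |: (B :\ i))%SET).
Proof.
have AM' := lattice_path_raise_sub hAB hi' hiB hi'B (lattice_path_lower hAB).
have AB' : gale_le A (i' |: (B :\ i))%SET by move: AM'; rewrite inE => /andP[].
have mv' := lattice_path_MV R AB'.
have submodE S := submod_raise R S hAB hi' hiB hi'B.
(* The claimed polytope is a candidate; any other candidate [Q] has the same submodular function and
   hence equals it. *)
apply: xget_unique => [//|Q [[[gQ _] _] Qsub]].
by apply: submod_inj => [//||S]; [case: mv' => -[]|rewrite Qsub submodE].
Qed.
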